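(* Let $M,N\in\mathcal{HS}$ be such that the ratio $x\mapsto\frac{M(x,1)}{N(x,1)}$ (for $x\in\mathbb{R}_+$) is bounded from above, and let $K\colon\mathbb{R}_+^2\to\mathbb{R}_+$ be the (uniquely determined) $(M,N)$-invariant mean. Then (i) $\operatorname{lord}(K)\ge\dfrac{\operatorname{lord}(N)}{1+\operatorname{uord}(N)-\operatorname{lord}(M)}$; (ii) $\operatorname{uord}(K)\le\dfrac{\operatorname{uord}(N)}{1+\operatorname{lord}(N)-\operatorname{uord}(M)}$ unless $\operatorname{lord}(N)=0$ and $\operatorname{uord}(M)=1$.
   Context: $\mathbb{R}_+:=(0,\infty)$. A (bivariate) mean is an arbitrary function $M\colon\mathbb{R}_+\times\mathbb{R}_+\to\mathbb{R}_+$ with $\min(x,y)\le M(x,y)\le\max(x,y)$ for all $x,y\in\mathbb{R}_+$. It is symmetric if $M(x,y)=M(y,x)$ for all $x,y\in\mathbb{R}_+$, and homogeneous if $M(tx,ty)=tM(x,y)$ for all $x,y,t\in\mathbb{R}_+$. $\mathcal{HS}$ denotes the family of all homogeneous, symmetric means $M\colon\mathbb{R}_+^2\to\mathbb{R}_+$. For $M\in\mathcal{HS}$ the lower order and upper order are the real numbers $$\operatorname{lord}(M):=\sup\Big\{\alpha\in\mathbb{R}\colon \limsup_{x\to0^+}\frac{M(x,1)}{x^\alpha}=0\Big\},\qquad \operatorname{uord}(M):=\inf\Big\{\alpha\in\mathbb{R}\colon \liminf_{x\to0^+}\frac{M(x,1)}{x^\alpha}=\infty\Big\}.$$ A mean $K$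 is $(M,N)$-invariant if $K\big(M(x,y),N(x,y)\big)=K(x,y)$ for all $x,y\in\mathbb{R}_+$. When $M,N\in\mathcal{HS}$ and the $(M,N)$-invariant mean $K$ is uniquely determined, $K$ also belongs to $\mathcal{HS}$, so its lower and upper orders are defined. *)

(* Defs.v *)
From mathcomp Require Import all_boot all_order all_algebra.
From mathcomp Require Import all_classical all_reals all_analysis.

Set Implicit Arguments.
Unset Strict Implicit.
Unset Printing Implicit Defensive.

Import Order.TTheory GRing.Theory Num.Theory.
Import numFieldNormedType.Exports.

Local Open Scope classical_set_scope.
Local Open Scope ring_scope.

(* A function on pairs of positive reals is represented by a total function    *)
(* R -> R -> R; its values elsewhere are irrelevant, so every condition below  *)
(* (including uniqueness of the invariant mean) only concerns positive         *)
(* arguments.                                                                  *)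

Definition is_mean (R : realType) (M : R -> R -> R) : Prop :=
  forall x y : R, 0 < x -> 0 < y ->
    Num.min x y <= M x y /\ M x y <= Num.max x y.

Definition symmetric_mean (R : realType) (M : R -> R -> R) : Prop :=
  forall x y : R, 0 < x -> 0 < y -> M x y = M y x.

Definition homogeneous_mean (R : realType) (M : R -> R -> R) : Prop :=
  forall x y t : R, 0 < x -> 0 < y -> 0 < t -> M (t * x) (t * y) = t * M x y.

Definition HS (R : realType) : set (R -> R -> R) :=
  [set M | [/\ is_mean M, homogeneous_mean M & symmetric_mean M]].

Definition lord (R : realType) (M : R -> R -> R) : R :=
  sup [set alpha : R |
    limf_esup (fun x : R => (M x 1 / x `^ alpha)%:E) 0^'+ = 0%:E].

Definition uord (R : realType) (M : R -> R -> R) : R :=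
  inf [set alpha : R |
    limf_einf (fun x : R => (M x 1 / x `^ alpha)%:E) 0^'+ = +oo%E].

Definition invariant_mean (R : realType) (M N K : R -> R -> R) : Prop :=
  is_mean K /\
  forall x y : R, 0 < x -> 0 < y -> K (M x y) (N x y) = K x y.

Definition unique_invariant_mean (R : realType) (M N K : R -> R -> R) : Prop :=
  invariant_mean M N K /\
  forall K' : R -> R -> R, invariant_mean M N K' ->
    forall x y : R, 0 < x -> 0 < y -> K' x y = K x y.

(* Main.v *)
(** Uniqueness makes K homogeneous, so invariance at (x, 1) reads
    K(x,1) = N(x,1) K(r,1) with r = M(x,1)/N(x,1). As r stays in a bounded
    interval (0, C], K(r,1) <= c r^a holds for all such r whenever a < lord K
    (and for a = 0), hence K(x,1) <= c N(x,1)^(1-a) M(x,1)^a. Comparing orders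
    at 0 and letting a tend to lord K gives
    (1 - lord K) lord N + lord K lord M <= lord K, that is
    lord N <= lord K (1 + lord N - lord M), which is stronger than (i) because
    lord N <= uord N. Part (ii) is dual. *)

Require Import Defs.
From mathcomp Require Import all_boot all_order all_algebra.
From mathcomp Require Import all_classical all_reals all_analysis.
From mathcomp Require Import ring lra.

Set Implicit Arguments.
Unset Strict Implicit.

Import Order.TTheory GRing.Theory Num.Theory.
Import numFieldNormedType.Exports.

Local Open Scope classical_set_scope.
Local Open Scope ring_scope.

(** * Limit superior and inferior as eventual bounds *)

Lemma limf_esup_eq0P (R : realType) (F : set_system R) (g : R -> R) :
  ProperFilter F -> (\forall x \near F, 0 <= g x) ->
  limf_esup (fun x => (g x)%:E) F = 0%:E <->
  forall e, 0 < e -> \forall x \near F, g x <= e.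
Proof.
move=> PF g0; rewrite limf_esupE; split=> [g_lim e e0|g_lim].
  have /ereal_inf_lt[_ [V FV <-] supV] : (ereal_inf [set ereal_sup
    [set (g x)%:E | x in V] | V in F] < e%:E)%E by rewrite g_lim lte_fin.
  apply: filterS FV => x Vx; rewrite -lee_fin; apply: le_trans (ltW supV).
  by apply: ereal_sup_ubound; exists x.
apply/eqP; rewrite eq_le; apply/andP; split.
  apply/lee_addgt0Pr => e e0; rewrite add0e.
  apply: (@le_trans _ _ (ereal_sup [set (g x)%:E | x in [set x | g x <= e]])).
    by apply: ereal_inf_lbound; exists [set x | g x <= e] => //; exact: g_lim.
  by apply: ge_ereal_sup => _ [x /= gx <-]; rewrite lee_fin.
apply: le_ereal_inf_tmp => _ [V FV <-].
have [x [Vx gx]] := filter_ex (filterI FV g0).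
by apply: le_trans (ereal_sup_ubound _); last by exists x; [exact: Vx|].
Qed.

Lemma limf_einf_eqyP (R : realType) (F : set_system R) (g : R -> R) :
  Filter F ->
  limf_einf (fun x => (g x)%:E) F = +oo%E <->
  forall A, \forall x \near F, A <= g x.
Proof.
move=> PF; rewrite limf_einfE; split=> [g_lim A|g_lim].
  have /ereal_sup_gt[_ [V FV <-] infV] : (A%:E < ereal_sup [set ereal_inf
    [set (g x)%:E | x in V] | V in F])%E by rewrite g_lim ltry.
  apply: filterS FV => x Vx; rewrite -lee_fin; apply: le_trans (ltW infV) _.
  by apply: ereal_inf_lbound; exists x.
apply/eqyP => A _.
apply: (@le_trans _ _ (ereal_inf [set (g x)%:E | x in [set x | A <= g x]])).
  by apply: le_ereal_inf_tmp => _ [x /= gx <-]; rewrite lee_fin.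
by apply: ereal_sup_ubound; exists [set x | A <= g x] => //; exact: g_lim.
Qed.

(** * Lower and upper order of a single mean *)

Section Order.
Variables (R : realType) (M : R -> R -> R).
Hypothesis M_mean : is_mean M.

Lemma mean_gt0 x y : 0 < x -> 0 < y -> 0 < M x y.
Proof.
move=> x0 y0; have [+ _] := M_mean x0 y0.
by apply: lt_le_trans; rewrite lt_min x0.
Qed.

Lemma near_itv01 : \forall x \near (0 : R)^'+, 0 < x < 1.
Proof.
near=> x; apply/andP; split; near: x; [exact: nbhs_right_gt|exact: nbhs_right_lt].
Unshelve. all: by end_near. Qed.

Lemma near_right0_ex (P : set R) :
  (\forall x \near 0^'+, P x) -> exists2 x, 0 < x < 1 & P x.
Proof.
move=> /(filterI near_itv01)/(@filter_ex _ _ (at_right_proper_filter 0)).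
by move=> [x [x01 Px]]; exists x.
Qed.

Lemma mean1_bounds x : 0 < x < 1 -> x <= M x 1 <= 1.
Proof.
move=> /andP[x0 x1]; have [] := M_mean x0 ltr01.
by rewrite min_l ?max_r ?(ltW x1)// => -> ->.
Qed.

Lemma lord_setP alpha :
  limf_esup (fun x : R => (M x 1 / x `^ alpha)%:E) 0^'+ = 0%:E <->
  forall e, 0 < e -> \forall x \near 0^'+, M x 1 <= e * x `^ alpha.
Proof.
rewrite limf_esup_eq0P; last first.
  near=> x; have /andP[x0 _] : 0 < x < 1 by near: x; exact: near_itv01.
  by rewrite divr_ge0 ?powR_ge0 ?ltW ?mean_gt0.
split=> H e /H {}H; near=> x.
  have x0 : 0 < x by near: x; exact: nbhs_right_gt.
  by rewrite -ler_pdivrMr ?powR_gt0//; near: x.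
have x0 : 0 < x by near: x; exact: nbhs_right_gt.
by rewrite ler_pdivrMr ?powR_gt0//; near: x.
Unshelve. all: by end_near. Qed.

Lemma uord_setP alpha :
  limf_einf (fun x : R => (M x 1 / x `^ alpha)%:E) 0^'+ = +oo%E <->
  forall A, \forall x \near 0^'+, A * x `^ alpha <= M x 1.
Proof.
rewrite limf_einf_eqyP.
split=> H A; have {}H := H A; near=> x.
  have x0 : 0 < x by near: x; exact: nbhs_right_gt.
  by rewrite -ler_pdivlMr ?powR_gt0//; near: x.
have x0 : 0 < x by near: x; exact: nbhs_right_gt.
by rewrite ler_pdivlMr ?powR_gt0//; near: x.
Unshelve. all: by end_near. Qed.

Lemma near_powR_le p (e : R) : 0 < p -> 0 < e ->
  \forall x \near 0^'+, x `^ p <= e.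
Proof.
move=> p0 e0; have /cvgr0Pnorm_le/(_ e e0) := powR_cvg0 p0.
by apply: filterS => x; apply: le_trans (ler_norm _).
Qed.

Lemma near_powR_dominated c alpha beta (e : R) : alpha < beta -> 0 < e ->
  \forall x \near 0^'+, c * x `^ beta <= e * x `^ alpha.
Proof.
move=> ab e0; have k0 : 0 < e / (`|c| + 1) by rewrite divr_gt0// ltr_wpDl.
have ba0 : 0 < beta - alpha by rewrite subr_gt0.
near=> x; have x0 : 0 < x by near: x; exact: nbhs_right_gt.
have xk : x `^ (beta - alpha) <= e / (`|c| + 1).
  by near: x; exact: near_powR_le.
rewrite -[beta](subrK alpha) powRD ?(gt_eqF x0) ?implybT// mulrA ler_wpM2r ?powR_ge0//.
apply: le_trans (_ : (`|c| + 1) * x `^ (beta - alpha) <= _).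
  by rewrite ler_wpM2r ?powR_ge0// (le_trans (ler_norm c))// lerDl.
by rewrite mulrC -ler_pdivlMr// ltr_wpDl.
Unshelve. all: by end_near. Qed.

Lemma lord_set_ge c alpha beta : beta < alpha ->
  (\forall x \near 0^'+, M x 1 <= c * x `^ alpha) ->
  limf_esup (fun x : R => (M x 1 / x `^ beta)%:E) 0^'+ = 0%:E.
Proof.
move=> ba H; apply/lord_setP => e e0.
apply: filterS2 H (near_powR_dominated c ba e0) => x; exact: le_trans.
Qed.

Lemma uord_set_le c alpha beta : 0 < c -> alpha < beta ->
  (\forall x \near 0^'+, c * x `^ alpha <= M x 1) ->
  limf_einf (fun x : R => (M x 1 / x `^ beta)%:E) 0^'+ = +oo%E.
Proof.
move=> c0 ab H; apply/uord_setP => A.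
apply: filterS2 (near_powR_dominated A ab c0) H => x; exact: le_trans.
Qed.

(** An exponent above 1 would force [M x 1 <= x / 2] near 0, against [x <= M x 1]. The bound is what
    makes [sup] in [lord] a genuine supremum rather than a default value. *)
Let lord_set_ub : ubound [set alpha : R |
    limf_esup (fun x : R => (M x 1 / x `^ alpha)%:E) 0^'+ = 0%:E] 1.
Proof.
move=> alpha /= /lord_setP/(_ 2^-1); rewrite invr_gt0 ltr0n => /(_ isT) H.
rewrite leNgt; apply/negP => a1.
have [x x01 Hx] := near_right0_ex H.
have /andP[xM _] := mean1_bounds x01; have /andP[x0 x1] := x01.
have : x `^ alpha <= x by apply: ge1r_powR; rewrite ?x0 ltW.
by move: Hx => /=; lra.
Qed.

Let uord_set_lb : lbound [set alpha : R |
    limf_einf (fun x : R => (M x 1 / x `^ alpha)%:E) 0^'+ = +oo%E] 0.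
Proof.
move=> alpha /= /uord_setP/(_ 2) H.
rewrite leNgt; apply/negP => a0.
have [x x01 Hx] := near_right0_ex H.
have /andP[_ M1] := mean1_bounds x01; have /andP[x0 x1] := x01.
have : x `^ 0 <= x `^ alpha by apply: ger_powR; rewrite ?x0 ltW.
by rewrite powRr0; move: Hx => /=; lra.
Qed.

(** Every exponent strictly below [alpha] is admissible, since the gap absorbs [c]. If
    [lord M < alpha], their midpoint would be admissible and exceed the supremum. *)
Lemma lord_ge c alpha : (\forall x \near 0^'+, M x 1 <= c * x `^ alpha) ->
  alpha <= lord M.
Proof.
move=> H; rewrite leNgt; apply/negP => /midf_lt[l1 l2].
move: l1; apply/negP; rewrite -leNgt.
by apply: (ub_le_sup _ (lord_set_ge l2 H)); exists 1; exact: lord_set_ub.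
Qed.

Lemma uord_le c alpha : 0 < c ->
  (\forall x \near 0^'+, c * x `^ alpha <= M x 1) -> uord M <= alpha.
Proof.
move=> c0 H; rewrite leNgt; apply/negP => /midf_lt[l1 l2].
move: l2; apply/negP; rewrite -leNgt.
by apply: (ge_inf _ (uord_set_le c0 l1 H)); exists 0; exact: uord_set_lb.
Qed.

Let near_lord0 : \forall x \near 0^'+, M x 1 <= 1 * x `^ 0.
Proof.
by apply: filterS near_itv01 => x /mean1_bounds/andP[_]; rewrite powRr0 mulr1.
Qed.

Let near_uord1 : \forall x \near 0^'+, 1 * x `^ 1 <= M x 1.
Proof.
apply: filterS near_itv01 => x /[dup] /andP[x0 _] /mean1_bounds/andP[+ _].
by rewrite powRr1 ?(ltW x0)// mul1r.
Qed.

Lemma lord_ge0 : 0 <= lord M. Proof. exact: lord_ge near_lord0. Qed.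

Lemma uord_le1 : uord M <= 1. Proof. exact: uord_le near_uord1. Qed.

(** Some admissible [beta] lies above [alpha], and powers decrease in the exponent on (0, 1); hence
    the constant can be taken to be 1. *)
Lemma lt_lord alpha : alpha < lord M ->
  \forall x \near 0^'+, M x 1 <= x `^ alpha.
Proof.
have ex : [set alpha : R |
    limf_esup (fun x : R => (M x 1 / x `^ alpha)%:E) 0^'+ = 0%:E] !=set0.
  by exists (-1); apply: lord_set_ge near_lord0; rewrite ltrN10.
move=> /(sup_gt ex)[beta /lord_setP/(_ 1 ltr01) H ab].
apply: filterS2 H near_itv01 => x Hx /andP[x0 x1].
rewrite mul1r in Hx; apply: le_trans Hx _.
by apply: ger_powR; rewrite ?x0 ltW.
Qed.

Lemma uord_lt alpha : uord M < alpha ->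
  \forall x \near 0^'+, x `^ alpha <= M x 1.
Proof.
have ex : [set alpha : R |
    limf_einf (fun x : R => (M x 1 / x `^ alpha)%:E) 0^'+ = +oo%E] !=set0.
  by exists 2; apply: uord_set_le near_uord1; rewrite ?ltr1n.
move=> /(inf_lt ex)[beta /uord_setP/(_ 1) H ab].
apply: filterS2 H near_itv01 => x Hx /andP[x0 x1].
rewrite mul1r in Hx; apply: le_trans Hx.
by apply: ger_powR; rewrite ?x0 ltW.
Qed.

Lemma lord_le1 : lord M <= 1.
Proof.
by apply: ge_sup => //; exists (-1); apply: lord_set_ge near_lord0; rewrite ltrN10.
Qed.

Lemma uord_ge0 : 0 <= uord M.
Proof.
by apply: lb_le_inf => //; exists 2; apply: uord_set_le near_uord1; rewrite ?ltr1n.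
Qed.

Lemma lord_le_uord : lord M <= uord M.
Proof.
(* Two exponents b < a are placed strictly between [uord M] and [lord M]; then
   [x^b <= M x 1 <= x^a <= x^b / 2] for some x > 0, which is absurd. *)
rewrite leNgt; apply/negP => /midf_lt[ub bl].
have [ba al] := midf_lt bl.
have half0 : (0 : R) < 2^-1 by rewrite invr_gt0.
have [x x01 [[Mb Ma] ab]] := near_right0_ex
  (filterI (filterI (uord_lt ub) (lt_lord al)) (near_powR_dominated 1 ba half0)).
have := powR_gt0 ((uord M + lord M) / 2) (proj1 (andP x01)).
by move: Mb Ma ab => /=; lra.
Qed.

(** * Power bounds on a whole interval (0, C] *)

Lemma near_right0_lt (P : set R) :
  (\forall x \near 0^'+, P x) -> exists2 d, 0 < d & forall x, 0 < x < d -> P x.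
Proof.
move=> [d /= d0 Pd]; exists d => // x /andP[x0 xd].
by apply: Pd => //=; rewrite sub0r normrN gtr0_norm.
Qed.

(** Below some [d] the order gives the bound; on [d, C] the mean is at most [max C 1] while [r]^
    alpha[is at least]d [^ alpha]. The case [alpha = 0] covers means of lower order 0, which have no
    nonnegative exponent below their order. *)
Lemma mean_le_powR C alpha : 0 <= alpha -> alpha < lord M \/ alpha = 0 ->
  exists2 c, 0 < c & forall r, 0 < r <= C -> M r 1 <= c * r `^ alpha.
Proof.
move=> alpha0 alphaM.
have M_max r : 0 < r <= C -> M r 1 <= Num.max C 1.
  move=> /andP[r0 rC]; apply: le_trans (M_mean r0 ltr01).2 _.
  by rewrite ge_max !le_max rC lexx orbT.
have max0 : 0 < Num.max C 1 by rewrite lt_max ltr01 orbT.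
case: alphaM => [alphaM|->]; last first.
  by exists (Num.max C 1) => // r /M_max; rewrite powRr0 mulr1.
have [d d0 Md] := near_right0_lt (lt_lord alphaM).
have k0 : 0 < Num.max C 1 / d `^ alpha by rewrite divr_gt0 ?powR_gt0.
exists (1 + Num.max C 1 / d `^ alpha); first by rewrite addr_gt0.
move=> r /[dup] rC /andP[r0 _]; have [rd|dr] := ltP r d.
  apply: le_trans (Md r _) _; first by rewrite r0.
  by rewrite ler_peMl ?powR_ge0// lerDl ltW.
apply: le_trans (M_max r rC) _; rewrite mulrDl mul1r ler_wpDl ?powR_ge0//.
rewrite mulrAC ler_pdivlMr ?powR_gt0// ler_wpM2l ?(ltW max0)//.
by rewrite ge0_ler_powR// nnegrE ltW.
Qed.

Lemma mean_ge_powR C beta : 0 <= beta -> uord M < beta \/ beta = 1 ->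
  exists2 c, 0 < c & forall r, 0 < r <= C -> c * r `^ beta <= M r 1.
Proof.
move=> beta0 betaM.
have M_min r : 0 < r -> Num.min r 1 <= M r 1.
  by move=> r0; apply: (M_mean r0 ltr01).1.
have max1 : 1 <= Num.max C 1 by rewrite le_max lexx orbT.
have max0 : 0 < Num.max C 1 by exact: lt_le_trans max1.
case: betaM => [betaM|->]; last first.
  (* On (0, C] both [r] and 1 are at least [r / max C 1]. *)
  exists (Num.max C 1)^-1; first by rewrite invr_gt0.
  move=> r /andP[r0 rC]; apply: le_trans (M_min r r0).
  rewrite powRr1 ?(ltW r0)// mulrC le_min !ler_pdivrMr// mul1r.
  by rewrite ler_peMr ?(ltW r0)//= le_max rC.
have [d d0 Md] := near_right0_lt (uord_lt betaM).
have min0 : 0 < Num.min d 1 by rewrite lt_min d0 ltr01.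
have k0 : 0 < Num.min d 1 / Num.max C 1 `^ beta by rewrite divr_gt0 ?powR_gt0.
(* The entry 1 serves [r < d]; the other serves [r >= d], where the mean is at least [min d 1] and
   [r]^ beta[is at most]max C 1 [^ beta]. *)
exists (Num.min 1 (Num.min d 1 / Num.max C 1 `^ beta)).
  by rewrite lt_min ltr01.
move=> r /andP[r0 rC]; have [rd|dr] := ltP r d.
  apply: le_trans (Md r _); last by rewrite r0.
  by rewrite ler_piMl ?powR_ge0// ge_min lexx.
apply: le_trans (M_min r r0).
apply: (@le_trans _ _ (Num.min d 1)); last first.
  by rewrite le_min !ge_min dr lexx orbT.
apply: (@le_trans _ _ (Num.min d 1 / Num.max C 1 `^ beta * r `^ beta)).
  by rewrite ler_wpM2r ?powR_ge0// ge_min lexx orbT.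
rewrite mulrAC ler_pdivrMr ?powR_gt0// ler_wpM2l ?(ltW min0)//.
by rewrite ge0_ler_powR// ?nnegrE ?(ltW r0) ?(ltW max0)// le_max rC.
Qed.

End Order.

(** * Homogeneity of the invariant mean *)

Lemma unique_invariant_homogeneous (R : realType) (M N K : R -> R -> R) :
  is_mean M -> is_mean N -> homogeneous_mean M -> homogeneous_mean N ->
  unique_invariant_mean M N K -> homogeneous_mean K.
Proof.
move=> meanM meanN homM homN [[meanK invK] uniqK] x y t x0 y0 t0.
(* Homogeneity of [M] and [N] makes the rescaled mean invariant too, so uniqueness identifies it
   with [K]. *)
suff invK' : invariant_mean M N (fun x y => K (t * x) (t * y) / t).
  by rewrite -(uniqK _ invK' x y x0 y0) [RHS]mulrC divfK ?gt_eqF.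
split=> [u v u0 v0|u v u0 v0].
  have [] := meanK _ _ (mulr_gt0 t0 u0) (mulr_gt0 t0 v0).
  rewrite -maxr_pMr ?(ltW t0)// -minr_pMr ?(ltW t0)//.
  by rewrite ler_pdivlMr// ler_pdivrMr// ![_ * t]mulrC.
by rewrite -homM// -homN// invK ?mulr_gt0.
Qed.

(** * Order inequalities for the invariant mean *)

Section InvariantOrder.
Variables (R : realType) (M N K : R -> R -> R).
Hypotheses (meanM : is_mean M) (meanN : is_mean N) (meanK : is_mean K).

(** Power bounds are available only strictly below each order, so both orders are lowered by [e];
    the weights sum to 1, so the total loss is exactly [e]. Nonnegative weights keep the powers
    monotone. *)
Lemma lord_weighted_le c alpha : 0 < c -> 0 <= alpha <= 1 ->
  (\forall x \near 0^'+, K x 1 <= c * (N x 1 `^ (1 - alpha) * M x 1 `^ alpha)) ->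
  (1 - alpha) * lord N + alpha * lord M <= lord K.
Proof.
move=> c0 /andP[alpha0 alpha1] H; apply/ler_addgt0Pr => e e0.
rewrite -lerBlDr.
have ltN : lord N - e < lord N by rewrite gtrBl.
have ltM : lord M - e < lord M by rewrite gtrBl.
rewrite (_ : _ - e = (lord N - e) * (1 - alpha) + (lord M - e) * alpha); last by ring.
apply: (lord_ge meanK (c := c)); near=> x.
have x0 : 0 < x by near: x; exact: nbhs_right_gt.
have Nx : N x 1 <= x `^ (lord N - e) by near: x; exact: (lt_lord meanN ltN).
have Mx : M x 1 <= x `^ (lord M - e) by near: x; exact: (lt_lord meanM ltM).
apply: (@le_trans _ _ (c * (N x 1 `^ (1 - alpha) * M x 1 `^ alpha))).
  by near: x.
apply: ler_wpM2l (ltW c0) _ _ _; rewrite (@powRD _ x) ?(gt_eqF x0) ?implybT// 2!powRrM.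
have N0 := mean_gt0 meanN x0 ltr01; have M0 := mean_gt0 meanM x0 ltr01.
apply: ler_pM (powR_ge0 _ _) (powR_ge0 _ _) _ _; apply: ge0_ler_powR;
  by rewrite ?nnegrE ?powR_ge0 ?subr_ge0 ?(ltW N0) ?(ltW M0).
Unshelve. all: by end_near. Qed.

Lemma uord_weighted_ge c beta : 0 < c -> 0 <= beta <= 1 ->
  (\forall x \near 0^'+, c * (N x 1 `^ (1 - beta) * M x 1 `^ beta) <= K x 1) ->
  uord K <= (1 - beta) * uord N + beta * uord M.
Proof.
move=> c0 /andP[beta0 beta1] H; apply/ler_addgt0Pr => e e0.
have ltN : uord N < uord N + e by rewrite ltrDl.
have ltM : uord M < uord M + e by rewrite ltrDl.
rewrite (_ : _ + e = (uord N + e) * (1 - beta) + (uord M + e) * beta); last by ring.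
apply: (uord_le meanK c0); near=> x.
have x0 : 0 < x by near: x; exact: nbhs_right_gt.
have Nx : x `^ (uord N + e) <= N x 1 by near: x; exact: (uord_lt meanN ltN).
have Mx : x `^ (uord M + e) <= M x 1 by near: x; exact: (uord_lt meanM ltM).
apply: (@le_trans _ _ (c * (N x 1 `^ (1 - beta) * M x 1 `^ beta))); last first.
  by near: x.
apply: ler_wpM2l (ltW c0) _ _ _; rewrite (@powRD _ x) ?(gt_eqF x0) ?implybT// 2!powRrM.
have N0 := mean_gt0 meanN x0 ltr01; have M0 := mean_gt0 meanM x0 ltr01.
apply: ler_pM (powR_ge0 _ _) (powR_ge0 _ _) _ _; apply: ge0_ler_powR;
  by rewrite ?nnegrE ?powR_ge0 ?subr_ge0 ?(ltW N0) ?(ltW M0).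
Unshelve. all: by end_near. Qed.

Variable C : R.
Hypothesis ratio_le : forall x, 0 < x -> M x 1 / N x 1 <= C.
Hypotheses (homK : homogeneous_mean K) (invK : invariant_mean M N K).

Let ratio_itv x : 0 < x -> 0 < M x 1 / N x 1 <= C.
Proof. by move=> x0; rewrite divr_gt0 ?mean_gt0//= ratio_le. Qed.

Let invariant_ratio x : 0 < x -> K x 1 = N x 1 * K (M x 1 / N x 1) 1.
Proof.
move=> x0; have N0 := mean_gt0 meanN x0 ltr01.
rewrite -homK ?divr_gt0 ?mean_gt0//.
by rewrite mulr1 mulrCA divff ?gt_eqF// mulr1 invK.2.
Qed.

Let powR_weighted x alpha : 0 < x ->
  N x 1 * (M x 1 / N x 1) `^ alpha = N x 1 `^ (1 - alpha) * M x 1 `^ alpha.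
Proof.
move=> x0; have N0 := mean_gt0 meanN x0 ltr01; have M0 := mean_gt0 meanM x0 ltr01.
rewrite powRM ?invr_ge0 ?(ltW M0) ?(ltW N0)// powRB ?(gt_eqF N0) ?implybT//.
rewrite powRr1 ?(ltW N0)// -powR_inv1 ?(ltW N0)// -powRrM mulN1r powRN.
by rewrite mulrCA mulrC mulrAC.
Qed.

Lemma lord_invariant_ge :
  (1 - lord K) * lord N + lord K * lord M <= lord K.
Proof.
have N0 := lord_ge0 meanN; have M1 := lord_le1 meanM.
have K0 := lord_ge0 meanK; have K1 := lord_le1 meanK.
(* The truncation at 0 keeps [alpha] a valid weight when [lord K < e]; the exponent 0 is then
   covered by the trivial bound. *)
apply/ler_addgt0Pr => e e0; pose alpha := Num.max 0 (lord K - e).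
have alpha0 : 0 <= alpha by rewrite le_max lexx.
have alphaE : alpha < lord K \/ alpha = 0.
  by rewrite /alpha; case: (leP 0) => _; [left; rewrite gtrBl|right].
have alphaK : alpha <= lord K by rewrite ge_max K0 gerBl ltW.
have Kalpha : lord K - e <= alpha by rewrite le_max lexx orbT.
have [c c0 Kle] := mean_le_powR meanK C alpha0 alphaE.
have : (1 - alpha) * lord N + alpha * lord M <= lord K.
  apply: (lord_weighted_le c0); first by rewrite alpha0 (le_trans alphaK).
  near=> x; have x0 : 0 < x by near: x; exact: nbhs_right_gt.
  rewrite invariant_ratio// -powR_weighted// mulrCA.
  by rewrite ler_wpM2l ?Kle ?ratio_itv// ltW// mean_gt0.
(* Replacing [alpha] by [lord K] changes the weighted sum by this product, which is at most [e]
   because [lord M - lord N <= 1]. *)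
have : (lord K - alpha) * (lord M - lord N) <= (lord K - alpha) * 1.
  by rewrite ler_wpM2l ?subr_ge0//; lra.
lra.
Unshelve. all: by end_near. Qed.

Lemma uord_invariant_le :
  uord K <= (1 - uord K) * uord N + uord K * uord M.
Proof.
have N0 := uord_ge0 meanN; have M1 := uord_le1 meanM.
have K0 := uord_ge0 meanK; have K1 := uord_le1 meanK.
(* Dually, capping at 1 keeps [beta] a valid weight; the exponent 1 is covered by the lower bound
   through the minimum. *)
apply/ler_addgt0Pr => e e0; pose beta := Num.min 1 (uord K + e).
have beta1 : beta <= 1 by rewrite ge_min lexx.
have betaE : uord K < beta \/ beta = 1.
  by rewrite /beta; case: (leP 1) => _; [right|left; rewrite ltrDl].
have betaK : uord K <= beta by rewrite le_min K1 lerDl ltW.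
have Kbeta : beta <= uord K + e by rewrite ge_min lexx orbT.
have beta0 : 0 <= beta by exact: le_trans betaK.
have [c c0 Kge] := mean_ge_powR meanK C beta0 betaE.
have : uord K <= (1 - beta) * uord N + beta * uord M.
  apply: (uord_weighted_ge c0); first by rewrite beta0.
  near=> x; have x0 : 0 < x by near: x; exact: nbhs_right_gt.
  rewrite invariant_ratio// -powR_weighted// mulrCA.
  by rewrite ler_wpM2l ?Kge ?ratio_itv// ltW// mean_gt0.
have : (beta - uord K) * (uord M - uord N) <= (beta - uord K) * 1.
  by rewrite ler_wpM2l ?subr_ge0//; lra.
lra.
Unshelve. all: by end_near. Qed.

End InvariantOrder.

(** * Passage from the linear inequalities to the quotients *)

Theorem corollary3p4 (R : realType) (M N K : R -> R -> R)
    (HM : HS M) (HN : HS N)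
    (Hratio : has_ubound [set M x 1 / N x 1 | x in [set x : R | 0 < x]])
    (HK : unique_invariant_mean M N K) :
  lord N / (1 + uord N - lord M) <= lord K /\
  (~ (lord N = 0 /\ uord M = 1) ->
   uord K <= uord N / (1 + lord N - uord M)).
Proof.
have [meanM homM _] := HM; have [meanN homN _] := HN.
have [invK _] := HK; have [meanK _] := invK.
have homK := unique_invariant_homogeneous meanM meanN homM homN HK.
have [C ubC] := Hratio.
have ratio_le x : 0 < x -> M x 1 / N x 1 <= C by move=> x0; apply: ubC; exists x.
have lordK := lord_invariant_ge meanM meanN meanK ratio_le homK invK.
have uordK := uord_invariant_le meanM meanN meanK ratio_le homK invK.
have lN0 := lord_ge0 meanN; have luN := lord_le_uord meanN.
have lM1 := lord_le1 meanM; have uM1 := uord_le1 meanM.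
have lK0 := lord_ge0 meanK; have uK0 := uord_ge0 meanK.
split=> [|nondeg].
  (* The quotient is 0 by convention when its denominator vanishes. *)
  have [->|D0] := eqVneq (1 + uord N - lord M) 0; first by rewrite invr0 mulr0.
  have D_gt0 : 0 < 1 + uord N - lord M by rewrite lt0r D0; lra.
  by rewrite ler_pdivrMr//; nra.
(* As [lord N >= 0] and [uord M <= 1], this denominator vanishes only in the excluded case. *)
have D_gt0 : 0 < 1 + lord N - uord M.
  rewrite lt_neqAle; apply/andP; split; last by lra.
  by apply/negP => /eqP D0; apply: nondeg; split; lra.
(* The inequality [uordK] gives [uord K * (1 + uord N - uord M) <= uord N]; replacing [uord N] by
   the smaller [lord N] inside the factor weakens it. *)
by rewrite ler_pdivlMr//; nra.
Qed.
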